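(* Let $n$ be a natural number, let $a_1,\dots,a_n$ be natural numbers (positive integers) that are coprime, i.e. $\gcd(a_1,\dots,a_n)=1$, and let $b$ be a non-negative integer. Let $M$ be the least common multiple of $a_1,\dots,a_n$ and let $r\in\{0,1,\dots,M-1\}$ be the remainder of $b$ modulo $M$. If $$r>(n-1)M-\sum_{i=1}^{n}a_i,$$ then $$P(b)=\frac{M^{n-1}}{a_1a_2\cdots a_n}\binom{\lfloor b/M\rfloor+n-1}{n-1}\qquad\text{and}\qquad P(r)=\frac{M^{n-1}}{a_1a_2\cdots a_n}.$$
   Context: For an integer $l$, $P(l)$ denotes the number of $n$-tuples $(x_1,\dots,x_n)$ of non-negative integers with $\sum_{i=1}^n a_ix_i=l$. ''Coprime'' means that the greatest common divisor of all the numbers is $1$ (not necessarily pairwise coprime). *)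

(* Defs.v *)
From HB Require Import structures.
From mathcomp Require Import all_boot all_order all_algebra.

Set Implicit Arguments.
Unset Strict Implicit.
Unset Printing Implicit Defensive.

(* The number of n-tuples x of natural numbers with \sum_i a_i x_i = l.  When
   all the a_i are positive, every solution has x_i <= l, so that ranging over
   'I_l.+1 loses nothing: see denumerantP. *)
Definition denumerant (n : nat) (a : 'I_n -> nat) (l : nat) : nat :=
  #|[set x : {ffun 'I_n -> 'I_l.+1} | \sum_(i < n) a i * x i == l]|.

Lemma denumerantP (n : nat) (a : 'I_n -> nat) (l : nat) :
  (forall i, 0 < a i) ->
  exists s : seq {ffun 'I_n -> nat},
    [/\ uniq s, forall x, (x \in s) = (\sum_(i < n) a i * x i == l)
      & size s = denumerant a l].
Proof.
move=> a_gt0.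
pose f (x : {ffun 'I_n -> 'I_l.+1}) : {ffun 'I_n -> nat} :=
  [ffun i => nat_of_ord (x i)].
have f_inj : injective f.
  move=> x y /ffunP fxy; apply/ffunP => i; apply/val_inj.
  by have := fxy i; rewrite !ffunE.
pose S := [set x : {ffun 'I_n -> 'I_l.+1} | \sum_(i < n) a i * x i == l].
exists [seq f x | x <- enum S]; split.
- by rewrite map_inj_uniq ?enum_uniq.
- move=> x; apply/mapP/idP => [[y] | /eqP xl].
    rewrite mem_enum inE => /eqP yl ->; apply/eqP; rewrite -[RHS]yl.
    by apply: eq_bigr => i _; rewrite ffunE.
  have x_le i : x i < l.+1.
    rewrite ltnS -xl (bigD1 i) //=.
    by apply: leq_trans (leq_addr _ _); rewrite leq_pmull.
  exists [ffun i => Ordinal (x_le i)].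
    rewrite mem_enum inE; apply/eqP; rewrite -[RHS]xl.
    by apply: eq_bigr => i _; rewrite ffunE.
  by apply/ffunP => i; rewrite !ffunE.
- by rewrite size_map -cardE.
Qed.

(* Main.v *)
Require Import Defs.
From mathcomp Require Import all_boot all_order all_algebra.
From mathcomp Require Import zify.
Import Order.TTheory GRing.Theory Num.Theory.
Local Open Scope ring_scope.

(** Write m_i = M / a_i, and divide each coordinate of a solution of
    \sum_i a_i x_i = b by m_i: x_i = m_i z_i + y_i with y_i < m_i.  Since
    a_i m_i = M, the equation becomes M \sum_i z_i + \sum_i a_i y_i = b, so
    \sum_i a_i y_i is congruent to r modulo M.  As y_i <= m_i - 1, that sum is
    at most n M - \sum_i a_i, and the hypothesis on r says precisely that this
    is less than r + M.  Hence \sum_i a_i y_i = r, and then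
    \sum_i z_i = b %/ M: the two remaining equations are independent
    ([denumerant_factor]).

    The second one has 'C(b %/ M + n - 1, n - 1) solutions by stars and bars
    ([denumerant1]).  The first one counts a fibre of the map
    y |-> \sum_i a_i y_i from the product of the groups Z/m_i to Z/M.  It is a
    homomorphism, onto because the a_i are coprime, so that its M fibres are
    translates of each other and each has (\prod_i m_i) / M elements
    ([card_residue_fibre]); this is M ^ (n - 1) / \prod_i a_i.  Taking b = r in
    the factorisation gives the value of the denumerant at r. *)

(** * Coprime weights represent every residue *)

(** The combinations of the a_i modulo M form an ideal, since - x is
    (M - 1) x there; so Bezout's identity closes them under gcdn while the
    coefficients stay in nat. *)
Lemma gcdn_combination_mod (I : finType) (a : I -> nat) (M : nat) :
  (0 < M)%N ->
  exists u : I -> nat,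
    (\sum_i a i * u i = \big[gcdn/0]_i a i %[mod M])%N.
Proof.
move=> M_gt0.
pose K d := exists u : I -> nat, (\sum_i a i * u i = d %[mod M])%N.
apply: (big_ind K) => [|x y [u Ku] [v Kv]|i _].
- by exists (fun=> 0%N); rewrite big1 // => i _; rewrite muln0.
- have [->|x_gt0] := posnP x; first by rewrite gcd0n; exists v.
  have [kx ky /= Exy _] := egcdnP y x_gt0.
  exists (fun i => u i * kx + v i * (ky * M.-1))%N.
  rewrite (eq_bigr (fun i => a i * u i * kx + a i * v i * (ky * M.-1))%N);
    last by move=> i _; rewrite mulnDr !mulnA.
  rewrite big_split -!big_distrl /= -modnDm.
  rewrite -(modnMml (\sum_i a i * u i)%N) Ku -(modnMml (\sum_i a i * v i)%N) Kv.
  rewrite !modnMml modnDm.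
  have -> : (x * kx + y * (ky * M.-1) = ky * y * M + gcdn x y)%N.
    rewrite [(x * kx)%N]mulnC Exy addnAC; congr (_ + _)%N.
    by rewrite -[in RHS](prednK M_gt0) mulnS (mulnCA y) mulnA.
  by rewrite modnMDl.
- exists (fun j => nat_of_bool (j == i)); rewrite (bigD1 i) //= eqxx muln1.
  by rewrite big1 ?addn0 // => j /negPf->; rewrite muln0.
Qed.

(** * Equidistribution of the weighted sums over a box *)

(** The coordinates live in 'I_M.+1 rather than 'I_M only so that [inord]
    applies for every M. *)
Definition residue_box {I : finType} (a : I -> nat) (M : nat) :
    {set {ffun I -> 'I_M.+1}} :=
  [set y : {ffun I -> 'I_M.+1} | [forall i, y i < M %/ a i]%N].

Definition residue_fibre {I : finType} (a : I -> nat) (M c : nat) :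
    {set {ffun I -> 'I_M.+1}} :=
  [set y in residue_box a M | \sum_i a i * y i == c %[mod M]]%N.

Lemma card_residue_box (I : finType) (a : I -> nat) (M : nat) :
  #|residue_box a M| = (\prod_i (M %/ a i))%N.
Proof.
pose F (i : I) := [pred k : 'I_M.+1 | k < M %/ a i]%N.
have -> : #|residue_box a M| = #|family F|.
  by apply: eq_card => y; rewrite inE; apply/forallP/familyP.
rewrite card_family foldrE big_map enumT; apply: eq_bigr => i _.
rewrite -sum1_card -(big_ord_widen M.+1 (fun=> 1%N)); last exact/leqW/leq_div.
by rewrite sum1_card card_ord.
Qed.

(** Addition of u in the product of the cyclic groups Z/(M / a_i). *)
Definition residue_translate {I : finType} (a : I -> nat) {M : nat}
    (u : I -> nat) (y : {ffun I -> 'I_M.+1}) : {ffun I -> 'I_M.+1} :=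
  [ffun i => inord ((y i + u i) %% (M %/ a i))%N].

Lemma residue_translateE (I : finType) (a : I -> nat) (M : nat)
    (u : I -> nat) (y : {ffun I -> 'I_M.+1}) (i : I) :
  (0 < M)%N -> (a i %| M)%N ->
  residue_translate a u y i = ((y i + u i) %% (M %/ a i))%N :> nat.
Proof.
move=> M_gt0 aM; have a_gt0 := dvdn_gt0 M_gt0 aM.
rewrite ffunE inordK // ltnS (leq_trans (ltnW (ltn_pmod _ _))) ?leq_div //.
by rewrite divn_gt0 // dvdn_leq.
Qed.

Lemma residue_translate_box (I : finType) (a : I -> nat) (M : nat)
    (u : I -> nat) (y : {ffun I -> 'I_M.+1}) :
  (0 < M)%N -> (forall i, a i %| M)%N -> residue_translate a u y \in residue_box a M.
Proof.
move=> M_gt0 aM; rewrite inE; apply/forallP => i; rewrite residue_translateE //.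
apply: ltn_pmod; rewrite divn_gt0; first exact: dvdn_leq.
exact: dvdn_gt0 M_gt0 (aM i).
Qed.

Lemma residue_translate_inj (I : finType) (a : I -> nat) (M : nat)
    (u : I -> nat) :
  (0 < M)%N -> (forall i, a i %| M)%N ->
  {in residue_box a M &, injective (residue_translate a u)}.
Proof.
move=> M_gt0 aM x y; rewrite !inE => /forallP x_box /forallP y_box.
move=> /ffunP Exy; apply/ffunP => i; apply: val_inj => /=.
have /eqP := congr1 val (Exy i); rewrite /= !residue_translateE // eqn_modDr.
by rewrite !modn_small // => /eqP.
Qed.

(** Dropping a multiple of M %/ a i from coordinate i changes the weighted sum
    by a multiple of M, so a translation shifts it by a constant modulo M. *)
Lemma residue_translate_sum (I : finType) (a : I -> nat) (M : nat)
    (u : I -> nat) (y : {ffun I -> 'I_M.+1}) :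
  (0 < M)%N -> (forall i, a i %| M)%N ->
  (\sum_i a i * residue_translate a u y i
     = \sum_i a i * y i + \sum_i a i * u i %[mod M])%N.
Proof.
move=> M_gt0 aM; rewrite -big_split /=.
apply: (big_ind2 (fun s t : nat => s = t %[mod M])%N) => // [x1 x2 y1 y2 E1 E2|i _].
  by rewrite -modnDm E1 E2 modnDm.
rewrite residue_translateE // muln_modr [(a i * (M %/ a i))%N]mulnC divnK //.
by rewrite modn_mod mulnDr.
Qed.

(** A translation whose shift is d - c maps one fibre injectively into the
    other; coprimality provides it, because 1 is then a combination of the
    a_i modulo M. *)
Lemma card_residue_fibre_le (I : finType) (a : I -> nat) (M c d : nat) :
  (0 < M)%N -> (forall i, a i %| M)%N -> (\big[gcdn/0]_i a i = 1)%N ->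
  (#|residue_fibre a M c| <= #|residue_fibre a M d|)%N.
Proof.
move=> M_gt0 aM a_coprime.
have [u0 Eu0] := gcdn_combination_mod I a M M_gt0.
(* M.-1 * c + d is a nonnegative representative of d - c modulo M *)
pose u i := (u0 i * (M.-1 * c + d))%N.
have Eu : (c + \sum_i a i * u i = d %[mod M])%N.
  rewrite (eq_bigr (fun i => a i * u0 i * (M.-1 * c + d))%N);
    last by move=> i _; rewrite mulnA.
  rewrite -big_distrl -modnDmr -modnMml Eu0 a_coprime modnMml modnDmr mul1n.
  by rewrite addnA -mulSn (prednK M_gt0) mulnC modnMDl.
have T_inj := residue_translate_inj I a M u M_gt0 aM.
rewrite -(card_in_imset (f := residue_translate a u) (D := mem (residue_fibre a M c))).
  apply/subset_leq_card/subsetP => _ /imsetP[y + ->].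
  rewrite inE => /andP[_ /eqP Ey]; rewrite inE residue_translate_box //=.
  by rewrite residue_translate_sum // -modnDml Ey modnDml Eu.
by move=> x y; rewrite !inE => /andP[xb _] /andP[yb _]; apply: T_inj; rewrite inE.
Qed.

(** The box is the disjoint union of M fibres, which all have the same size
    because [card_residue_fibre_le] holds in both directions. *)
Lemma card_residue_fibre (I : finType) (a : I -> nat) (M c : nat) :
  (0 < M)%N -> (forall i, a i %| M)%N -> (\big[gcdn/0]_i a i = 1)%N ->
  (#|residue_fibre a M c| * M = \prod_i (M %/ a i))%N.
Proof.
move=> M_gt0 aM a_coprime; rewrite -card_residue_box -[RHS]sum1_card.
pose f (y : {ffun I -> 'I_M.+1}) :=
  Ordinal (ltn_pmod (\sum_i a i * y i)%N M_gt0).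
rewrite (partition_big f xpredT) //=.
transitivity (\sum_(d < M) #|residue_fibre a M c|)%N.
  by rewrite sum_nat_const card_ord mulnC.
apply: eq_bigr => d _.
have -> : #|residue_fibre a M c| = #|residue_fibre a M d|.
  by apply/eqP; rewrite eqn_leq !card_residue_fibre_le.
rewrite -sum1_card; apply: eq_bigl => y.
by rewrite !inE -val_eqE /= (modn_small (ltn_ord d)).
Qed.

(** * Splitting solutions into quotients and remainders *)

(** Stars and bars: with all weights equal to 1, the solutions are the weak
    compositions of q into n parts. *)
Lemma denumerant1 (n q : nat) :
  (0 < n)%N -> denumerant (fun _ : 'I_n => 1%N) q = 'C(q + n - 1, n - 1).
Proof.
case: n => // n _; rewrite addnS !subn1 /= addnC -card_ord_partitions.
rewrite /denumerant.
pose f (x : {ffun 'I_n.+1 -> 'I_q.+1}) := [tuple x i | i < n.+1].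
have f_bij : bijective f.
  exists (fun t : n.+1.-tuple 'I_q.+1 => [ffun i => tnth t i]) => [x|t].
    by apply/ffunP => i; rewrite ffunE tnth_mktuple.
  by apply: eq_from_tnth => i; rewrite tnth_mktuple ffunE.
rewrite -(card_imset _ (bij_inj f_bij)); apply: eq_card => t.
have [g fK gK] := f_bij.
rewrite -[t]gK mem_imset ?inE; last exact: bij_inj.
by rewrite big_map big_enum /=; under eq_bigr do rewrite mul1n.
Qed.

(** Each term satisfies a_i (y_i + 1) <= M. *)
Lemma residue_box_sum_le (I : finType) (a : I -> nat) (M : nat)
    (y : {ffun I -> 'I_M.+1}) :
  y \in residue_box a M -> (\sum_i a i * y i + \sum_i a i <= #|I| * M)%N.
Proof.
rewrite inE => /forallP y_box; rewrite -big_split -sum_nat_const /=.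
apply: leq_sum => i _; rewrite -mulnSr.
apply: leq_trans (leq_trunc_div M (a i)).
by rewrite [leqRHS]mulnC leq_mul2l y_box orbT.
Qed.

(** The hypothesis on b %% M says that no weighted sum of remainders reaches
    b %% M + M, which makes the sum of the remainders, and hence that of the
    quotients, the same for all solutions. *)
Lemma denumerant_factor (n : nat) (a : 'I_n -> nat) (M b : nat) :
  (0 < M)%N -> (forall i, a i %| M)%N ->
  (n * M < b %% M + M + \sum_(i < n) a i)%N ->
  denumerant a b
    = (denumerant (fun _ : 'I_n => 1%N) (b %/ M) * #|residue_fibre a M b|)%N.
Proof.
move=> M_gt0 aM r_large; set q := (b %/ M)%N.
have a_gt0 i : (0 < a i)%N := dvdn_gt0 M_gt0 (aM i).
have step_gt0 i : (0 < M %/ a i)%N by rewrite divn_gt0 // dvdn_leq.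
have aMK i k : (a i * (M %/ a i * k) = M * k)%N.
  by rewrite mulnA [(a i * _)%N]mulnC divnK.
rewrite /denumerant; set A := [set x | _]; set Z := [set x | _].
set Y := residue_fibre a M b.
have Y_sum (y : {ffun 'I_n -> 'I_M.+1}) :
    y \in residue_box a M -> (\sum_i a i * y i = b %[mod M])%N ->
    (\sum_i a i * y i = b %% M)%N.
  move=> y_box y_b; have := residue_box_sum_le _ a M y y_box.
  rewrite card_ord -y_b => y_le; move: r_large; rewrite -y_b.
  move: (\sum_i a i * y i)%N y_le => s s_le r_large.
  suff s_lt : (s %/ M < 1)%N by rewrite modn_small //; rewrite ltn_divLR ?mul1n in s_lt.
  rewrite -(ltn_pmul2r M_gt0) mul1n -(ltn_add2r (s %% M)%N) -divn_eq.
  by rewrite -(ltn_add2r (\sum_(i < n) a i)%N) (leq_ltn_trans s_le) // [(M + _)%N]addnC.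
(* Recomposition x_i = m_i z_i + y_i is the bijection from pairs of quotients
   and remainders to solutions. *)
pose f (zy : {ffun 'I_n -> 'I_q.+1} * {ffun 'I_n -> 'I_M.+1}) :
    {ffun 'I_n -> 'I_b.+1} :=
  [ffun i => inord (M %/ a i * zy.1 i + zy.2 i)%N].
have sum_mix (z : 'I_n -> nat) (y : 'I_n -> nat) :
    (\sum_i a i * (M %/ a i * z i + y i)
       = M * \sum_i 1 * z i + \sum_i a i * y i)%N.
  by rewrite big_distrr -big_split; apply: eq_bigr => i _; rewrite mulnDr aMK mul1n.
have term_le (x : 'I_n -> nat) i : (\sum_i a i * x i = b -> a i * x i <= b)%N.
  by move=> <-; rewrite (bigD1 i) //= leq_addr.
have fP (z : {ffun 'I_n -> 'I_q.+1}) (y : {ffun 'I_n -> 'I_M.+1}) :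
    z \in Z -> y \in Y ->
    (\sum_i a i * (M %/ a i * z i + y i) = b)%N
    /\ forall i, f (z, y) i = (M %/ a i * z i + y i)%N :> nat.
  rewrite inE => /eqP z_q; rewrite inE => /andP[y_box /eqP y_b].
  have Eb : (\sum_i a i * (M %/ a i * z i + y i) = b)%N.
    by rewrite sum_mix z_q Y_sum // mulnC -divn_eq.
  split=> // i; rewrite ffunE inordK // ltnS.
  by apply: leq_trans (term_le (fun i => M %/ a i * z i + y i)%N i Eb); rewrite leq_pmull.
have Y_lt y i : y \in Y -> (y i < M %/ a i)%N.
  by rewrite !inE => /andP[/forallP].
rewrite -cardsX -(card_in_imset (f := f) (D := mem (setX Z Y))).
  apply: eq_card => /= x; apply/idP/imsetP => [|[[z y] /setXP[zZ yY] ->]]; last first.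
    have [Eb Ef] := fP z y zZ yY; rewrite inE -[X in _ == X]Eb.
    by apply/eqP/eq_bigr => i _; rewrite Ef.
  rewrite inE => /eqP x_b.
  have x_le i : (a i * x i <= b)%N := term_le (fun i => x i) i x_b.
  pose z := [ffun i => inord (x i %/ (M %/ a i))] : {ffun 'I_n -> 'I_q.+1}.
  pose y := [ffun i => inord (x i %% (M %/ a i))] : {ffun 'I_n -> 'I_M.+1}.
  (* M (x_i %/ m_i) = a_i m_i (x_i %/ m_i) <= a_i x_i <= b, so x_i %/ m_i <= q *)
  have zE i : z i = (x i %/ (M %/ a i))%N :> nat.
    rewrite ffunE inordK // ltnS leq_divRL // mulnC -(aMK i).
    by rewrite (leq_trans _ (x_le i)) // leq_mul2l mulnC leq_trunc_div orbT.
  have yE i : y i = (x i %% (M %/ a i))%N :> nat.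
    by rewrite ffunE inordK // ltnS (leq_trans (ltnW (ltn_pmod _ _))) ?leq_div.
  have xE i : (M %/ a i * z i + y i = x i)%N.
    by rewrite zE yE mulnC -divn_eq.
  have y_box : y \in residue_box a M.
    by rewrite inE; apply/forallP => i; rewrite yE ltn_pmod.
  have Eb : (M * \sum_i 1 * z i + \sum_i a i * y i = b)%N.
    by rewrite -sum_mix -[RHS]x_b; apply: eq_bigr => i _; rewrite xE.
  have y_b : (\sum_i a i * y i = b %[mod M])%N by rewrite -[in RHS]Eb mulnC modnMDl.
  have yY : y \in Y by rewrite inE y_box y_b /=.
  have zZ : z \in Z.
    rewrite inE -(eqn_pmul2l M_gt0) -(eqn_add2r (b %% M)%N) [X in _ == X]addnC.
    by rewrite -{1}(Y_sum y) // Eb {1}(divn_eq b M) mulnC addnC.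
  exists (z, y); first by apply/setXP.
  have [_ Ef] := fP z y zZ yY.
  by apply/ffunP => i; apply: val_inj; rewrite /= Ef xE.
move=> [z y] [z' y'] /setXP[zZ yY] /setXP[z'Z y'Y] Ezy.
have [_ Ef] := fP z y zZ yY; have [_ Ef'] := fP z' y' z'Z y'Y.
have E i : (z i * (M %/ a i) + y i = z' i * (M %/ a i) + y' i)%N.
  by rewrite mulnC -Ef Ezy Ef' mulnC.
have Ey i : y i = y' i :> nat.
  by have := congr1 (modn^~ (M %/ a i)%N) (E i); rewrite !modnMDl !modn_small // Y_lt.
congr (_, _); apply/ffunP => i; apply: val_inj; rewrite /= ?Ey //.
by have /eqP := E i; rewrite Ey eqn_add2r eqn_pmul2r // => /eqP.
Qed.

Theorem corollary3p4 (n : nat) (a : 'I_n -> nat) (b : nat)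
  (n_gt0 : (0 < n)%N)
  (a_gt0 : forall i : 'I_n, (0 < a i)%N)
  (a_coprime : (\big[gcdn/0]_(i < n) a i = 1)%N) :
  let M := (\big[lcmn/1]_(i < n) a i)%N in
  let r := (b %% M)%N in
  r%:Z > (n%:Z - 1) * M%:Z - \sum_(i < n) (a i)%:Z ->
  (denumerant a b)%:R =
    (M%:R ^+ (n - 1) / \prod_(i < n) (a i)%:R)
      * 'C(b %/ M + n - 1, n - 1)%:R :> rat
  /\ (denumerant a r)%:R = M%:R ^+ (n - 1) / \prod_(i < n) (a i)%:R :> rat.
Proof.
move=> M r r_large.
have M_gt0 : (0 < M)%N.
  by apply: (big_ind (fun k => 0 < k)%N) => // x y; rewrite lcmn_gt0 => ->.
have aM i : (a i %| M)%N by rewrite /M (bigD1 i) //= dvdn_lcml.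
have r_large_nat : (n * M < r + M + \sum_(i < n) a i)%N.
  have Esum : (\sum_(i < n) (a i)%:Z) = (\sum_(i < n) a i)%N%:Z.
    by rewrite -natz natr_sum; apply: eq_bigr => i _; rewrite natz.
  move: r_large; rewrite Esum; move: (\sum_(i < n) a i)%N => s.
  by nia.
have M_neq0 : M%:R != 0 :> rat by rewrite pnatr_eq0 -lt0n.
have prod_neq0 : \prod_(i < n) (a i)%:R != 0 :> rat.
  by apply/prodf_neq0 => i _; rewrite pnatr_eq0 -lt0n.
have fibreE c :
    #|residue_fibre a M c|%:R = M%:R ^+ (n - 1) / \prod_(i < n) (a i)%:R :> rat.
  have prodE : (\prod_i (M %/ a i) * \prod_i a i = M ^ n)%N.
    rewrite -big_split -[in RHS](card_ord n) -prod_nat_const /=.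
    by apply: eq_bigr => i _; rewrite divnK.
  apply: (mulIf prod_neq0); rewrite divfK //; apply: (mulIf M_neq0).
  rewrite -exprSr subn1 prednK // mulrAC -natrM card_residue_fibre //.
  by rewrite -natr_prod -natrM prodE natrX.
split.
  by rewrite (denumerant_factor n a M b) // denumerant1 // natrM fibreE mulrC.
rewrite (denumerant_factor n a M r) ?modn_mod // denumerant1 //.
by rewrite divn_small ?ltn_pmod // add0n binn mul1n fibreE.
Qed.
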